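(* Let $n$ be a positive integer and let $A$ be an antipodal $5$-splitting of $Q_2^n$. Then the collection $\beta(A)$ of $5$-subsets of $\{1,\dots,n\}$ is equivalent either to $E=\{\{1,2,3,5,6\}, \{1,2,4,5,6\}, \{1,3,4,5,6\}, \{2,3,4,5,6\}, \{1,2,3,5,7\}, \{1,2,4,5,7\}, \{1,3,4,5,7\}, \{2,3,4,5,7\}, \{1,2,3,6,7\}, \{1,2,4,6,7\}, \{1,3,4,6,7\}, \{2,3,4,6,8\},\{2,3,4,7,8\},\{2,3,6,7,8\},\{2,4,6,7,8\},\{3,4,6,7,8\}\}$ or to $F=\{\{1,2,3,5,7\}, \{1,2,4,5,7\}, \{1,3,4,5,7\}, \{2,3,4,5,7\}, \{1,2,3,6,7\}, \{1,2,4,6,7\}, \{1,3,4,6,7\}, \{2,3,4,6,7\}, \{1,2,3,6,8\}, \{1,2,4,6,8\}, \{1,3,4,6,8\}, \{2,3,4,6,8\}, \{1,2,3,5,8\}, \{1,2,4,5,8\}, \{1,3,4,5,8\}, \{2,3,4,5,8\}\}$.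
   Context: $Q_2^n=\{0,1\}^n$ is the Boolean hypercube. For $0\le m\le n$, an $m$-face of $Q_2^n$ is given by a tuple $a=(a_1,\dots,a_n)\in\{0,1,*\}^n$ with exactly $m$ entries equal to $*$; it denotes the set $\{x\in Q_2^n : x_i=a_i \text{ whenever } a_i\in\{0,1\}\}$. The direction of a face is the set of positions of its asterisks; two faces are parallel if they have the same direction, and two parallel faces $a,b$ are antipodal if $b_i=1-a_i$ at every non-asterisk position $i$. For positive integers $k< n$, an antipodal $k$-splitting of $Q_2^n$ is a collection of exactly $2^k$ $(n-k)$-faces whose union is $Q_2^n$ and which contains no pair of parallel non-antipodal faces. For a face $a$ let $\beta(a)=\{i : a_i\in\{0,1\}\}$, and for a collection $A$ of faces let $\beta(A)=\{\beta(a): a\in A\}$ (a set of subsets). Two collections $U_1$ of subsets of a set $V_1$ and $U_2$ of subsets of a set $V_2$ are equivalent if there is an injection $f:V_1\to V_2$ with $U_2=\{f(u): u\in U_1\}$. *)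

(* Defs.v *)
From mathcomp Require Import all_boot.
Set Implicit Arguments. Unset Strict Implicit. Unset Printing Implicit Defensive.

(* Points of Q_2^n: boolean vectors indexed by 'I_n (coordinate i+1 of the paper is i). *)
Definition point (n : nat) := {ffun 'I_n -> bool}.
(* Faces: tuples in {0,1,*}^n, with * encoded as None. *)
Definition face (n : nat) := {ffun 'I_n -> option bool}.

Definition direction n (a : face n) : {set 'I_n} := [set i | a i == None].
Definition is_mface n (m : nat) (a : face n) : bool := #|direction a| == m.

Definition in_face n (a : face n) (x : point n) : bool :=
  [forall i, if a i is Some v then x i == v else true].

Definition parallel n (a b : face n) : bool := direction a == direction b.

Definition antipodal n (a b : face n) : bool :=
  parallel a b &&
  [forall i, if a i is Some v then b i == Some (~~ v) else true].

Definition antipodal_splitting (k n : nat) (A : {set face n}) : Prop :=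
  [/\ 0 < k < n,
      #|A| = 2 ^ k,
      (forall a, a \in A -> is_mface (n - k) a),
      (forall x : point n, exists2 a, a \in A & in_face a x) &
      (forall a b, a \in A -> b \in A -> a != b -> parallel a b -> antipodal a b)].

Definition beta n (a : face n) : {set 'I_n} := [set i | a i != None].
Definition betaA n (A : {set face n}) : {set {set 'I_n}} := [set beta a | a in A].

Definition equivalent (T1 T2 : finType) (U1 : {set {set T1}}) (U2 : {set {set T2}}) : Prop :=
  exists f : T1 -> T2, injective f /\ U2 = [set (f @: u) | u : {set T1} in U1].

(* subset of {1,...,8} given by a list of 1-based labels, as a subset of 'I_8 *)
Definition lab (s : seq nat) : {set 'I_8} := [set i : 'I_8 | (i : nat).+1 \in s].

Definition collE : {set {set 'I_8}} :=
  [set:: map lab [:: [:: 1;2;3;5;6]; [:: 1;2;4;5;6]; [:: 1;3;4;5;6]; [:: 2;3;4;5;6];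
                        [:: 1;2;3;5;7]; [:: 1;2;4;5;7]; [:: 1;3;4;5;7]; [:: 2;3;4;5;7];
                        [:: 1;2;3;6;7]; [:: 1;2;4;6;7]; [:: 1;3;4;6;7]; [:: 2;3;4;6;8];
                        [:: 2;3;4;7;8]; [:: 2;3;6;7;8]; [:: 2;4;6;7;8]; [:: 3;4;6;7;8]]].

Definition collF : {set {set 'I_8}} :=
  [set:: map lab [:: [:: 1;2;3;5;7]; [:: 1;2;4;5;7]; [:: 1;3;4;5;7]; [:: 2;3;4;5;7];
                        [:: 1;2;3;6;7]; [:: 1;2;4;6;7]; [:: 1;3;4;6;7]; [:: 2;3;4;6;7];
                        [:: 1;2;3;6;8]; [:: 1;2;4;6;8]; [:: 1;3;4;6;8]; [:: 2;3;4;6;8];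
                        [:: 1;2;3;5;8]; [:: 1;2;4;5;8]; [:: 1;3;4;5;8]; [:: 2;3;4;5;8]]].

(* Main.v *)
(* The indicators of the 32 faces sum to 1, so for every nonempty S the signs prod_(i in S) (-1)^(a i),
   summed over the faces a with S contained in beta a, cancel. For |S| = 5 this shows that
   A is a union of 16 antipodal pairs. For |S| = 4 the sign is the same for both members of
   a pair, so a subfamily of pairs which is unbalanced at S must be extended by a face that
   contains S in its base and, up to antipodes, differs on S at exactly one coordinate.
   Moreover any two faces from different pairs must both agree and differ somewhere.
   Starting from two neighbouring faces, this forcing is a finite search, run inside the kernel;
   new coordinates enter with a normalised sign. Every branch ends in a contradiction or in a
   balanced subfamily with more than ten pairs, which is then all of A, because a further
   face would bring five more; its bases are matched with E or F. *)
Require Import Defs.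
From mathcomp Require Import all_boot.
Set Implicit Arguments. Unset Strict Implicit. Unset Printing Implicit Defensive.

(** * Faces, antipodes and signs on the cube *)

Section Cube.
Variable n : nat.
Implicit Types (a b : face n) (x : point n) (S : {set 'I_n}) (i : 'I_n).

Definition antipode a : face n := [ffun i => omap negb (a i)].

(** [parity] and [face_parity] are the exponents of the character attached to [S]; the second is
    meaningful when [S] lies in the base of the face. *)
Definition parity S x : bool := odd #|[set i in S | x i]|.
Definition face_parity S a : bool := odd #|[set i in S | a i == Some true]|.

Definition flip_at i x : point n := [ffun j => x j (+) (j == i)].

Lemma antipodeK : involutive antipode.
Proof. by move=> a; apply/ffunP=> i; rewrite !ffunE; case: (a i) => // -[]. Qed.

Lemma beta_antipode a : beta (antipode a) = beta a.
Proof. by apply/setP=> i; rewrite !inE ffunE; case: (a i). Qed.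

Lemma direction_beta a : direction a = ~: beta a.
Proof. by apply/setP=> i; rewrite !inE negbK. Qed.

Lemma antipodalE a b : antipodal a b -> b = antipode a.
Proof.
case/andP=> /eqP/setP dab /forallP ab; apply/ffunP=> i; rewrite ffunE.
move: (ab i) (dab i); rewrite !inE; case: (a i) => [v /eqP -> //|_] /=.
by case: (b i).
Qed.

Lemma flip_atK i : involutive (flip_at i).
Proof. by move=> x; apply/ffunP=> j; rewrite !ffunE -addbA addbb addbF. Qed.

Lemma parity_flip_at S i x : i \in S -> parity S (flip_at i x) = ~~ parity S x.
Proof.
move=> iS; rewrite /parity (cardsD1 i) [in RHS](cardsD1 i) !inE iS ffunE eqxx /=.
have -> : [set j in S | flip_at i x j] :\ i = [set j in S | x j] :\ i.
  by apply/setP=> j; rewrite !inE !ffunE; case: eqP => //= _; rewrite addbF.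
by rewrite !oddD !oddb addbT addNb.
Qed.

Lemma in_faceP a x :
  reflect (forall i v, a i = Some v -> x i = v) (in_face a x).
Proof.
apply: (iffP forallP) => [H i v E|H i]; first by move: (H i); rewrite E => /eqP.
by case E: (a i) => [v|//]; apply/eqP/H.
Qed.

Lemma in_face_flip_at a i x : i \notin beta a ->
  in_face a (flip_at i x) = in_face a x.
Proof.
rewrite inE negbK => /eqP ai; apply: eq_forallb => j; rewrite ffunE.
by case: eqP => [->|_]; rewrite ?ai ?addbF.
Qed.

Lemma card_face a : #|[set x | in_face a x]| = 2 ^ #|direction a|.
Proof.
pose F i : pred bool := if a i is Some v then pred1 v else predT.
have -> : #|[set x | in_face a x]| = #|family F|.
  apply: eq_card => x; rewrite inE; apply/forallP/familyP => H i;
    by move: (H i); rewrite /F; case: (a i).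
rewrite card_family foldrE big_map big_enum -prod_nat_const.
rewrite [RHS]big_mkcond /=; apply: eq_bigr => i _; rewrite inE /F.
by case: (a i) => [v|] /=; rewrite ?card1 // card_bool.
Qed.

(** Flipping the free coordinate [i] preserves the face and reverses the parity on [S]. *)
Lemma parity_balanced a S i c : i \in S -> i \notin beta a ->
  #|[set x | in_face a x && (parity S x == c)]| =
  #|[set x | in_face a x && (parity S x == ~~ c)]|.
Proof.
move=> iS ia; rewrite -(card_imset _ (inv_inj (flip_atK i))).
apply: eq_card => x; rewrite inE; apply/imsetP/andP.
  by case=> y; rewrite inE => /andP[ay /eqP py] ->;
     rewrite in_face_flip_at // parity_flip_at // py.
case=> ax /eqP px; exists (flip_at i x); rewrite ?flip_atK // inE.
by rewrite in_face_flip_at // parity_flip_at // px negbK eqxx ax.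
Qed.

Lemma parity_in_face a S x : S \subset beta a -> in_face a x ->
  parity S x = face_parity S a.
Proof.
move=> /subsetP sub /in_faceP ax; congr (odd _); apply: eq_card => i.
rewrite !inE; case iS: (i \in S) => //=; move: (sub i iS); rewrite inE.
by case E: (a i) => [v|//] _; rewrite (ax i v E); case: v {E}.
Qed.

(** On [S] the true entries of the antipode are the false entries of [a], so the two counts add up
    to [#|S|]. *)
Lemma face_parity_antipode a S : S \subset beta a ->
  face_parity S (antipode a) = odd #|S| (+) face_parity S a.
Proof.
move=> /subsetP sub; rewrite /face_parity -(cardsID [set i | a i == Some true] S) oddD.
have -> : S :&: [set i | a i == Some true] = [set i in S | a i == Some true].
  by apply/setP=> i; rewrite !inE.
rewrite addbAC addbb addFb; congr (odd _); apply: eq_card => i.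
rewrite !inE ffunE; case iS: (i \in S) => //=; last by rewrite andbF.
by move: (sub i iS); rewrite inE; case: (a i) => [[]|].
Qed.

End Cube.

(** * Balance and antipodal pairs in a splitting *)

Section Splitting.
Variables (n : nat) (A : {set face n}).
Hypothesis splitA : antipodal_splitting 5 A.
Implicit Types (a b : face n) (x : point n) (S : {set 'I_n}) (i : 'I_n).

Lemma card_beta a : a \in A -> #|beta a| = 5.
Proof.
case: splitA => /andP[_ n5] _ dimA _ _ /dimA /eqP.
rewrite direction_beta => H.
have := cardsC (beta a); rewrite H card_ord => E.
by rewrite -(addnK (n - 5) #|beta a|) E subKn // ltnW.
Qed.

(** The 2^5 faces of 2^(n-5) points have 2^n points in all; as every point is covered, none is
    covered twice. *)
Lemma splitting_partition x : #|[set a in A | in_face a x]| = 1.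
Proof.
case: splitA => /andP[_ n5] cardA dimA covA _.
pose k y := #|[set a in A | in_face a y]|.
have k_gt0 y : 1 <= k y.
  by have [a aA ay] := covA y; apply/card_gt0P; exists a; rewrite inE aA.
have sumk : \sum_(y : point n) k y = \sum_(y : point n) 1.
  rewrite sum1_card card_ffun card_bool card_ord.
  under eq_bigr => y _ do rewrite /k -sum1_card big_mkcond /=.
  rewrite exchange_big /=.
  transitivity (\sum_(a in A) 2 ^ (n - 5)).
    rewrite [RHS]big_mkcond; apply: eq_bigr => a _; case aA: (a \in A).
      rewrite -(eqP (dimA a aA)) -card_face -sum1_card [RHS]big_mkcond.
      by apply: eq_bigr => y _; rewrite !inE aA.
    by apply: big1 => y _; rewrite inE aA.
  by rewrite sum_nat_const cardA -expnD subnKC // ltnW.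
have [_ /esym] := leqif_sum (fun y (_ : true) => leqif_eq (k_gt0 y)).
by rewrite sumk eqxx => /forallP/(_ x) /eqP.
Qed.

Lemma splitting_card (P : pred (point n)) :
  #|[set x | P x]| = \sum_(a in A) #|[set x | in_face a x && P x]|.
Proof.
transitivity (\sum_(x | P x) #|[set a in A | in_face a x]|).
  by rewrite -sum1dep_card; apply: eq_bigr => x _; rewrite splitting_partition.
under eq_bigr => x _ do rewrite -sum1_card big_mkcond /=.
rewrite exchange_big /= [RHS]big_mkcond; apply: eq_bigr => a _.
case aA: (a \in A); last by apply: big1 => x _; rewrite inE aA.
rewrite -sum1_card big_mkcond [RHS]big_mkcond; apply: eq_bigr => x _ /=.
by rewrite !inE aA andbC; case: (P x); rewrite ?andbF.
Qed.

Definition parity_class S c := [set a in A | (S \subset beta a) && (face_parity S a == c)].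

(* The degree-S Fourier coefficient of the constant function 1 vanishes. *)
Lemma faces_balanced S : S != set0 -> #|parity_class S true| = #|parity_class S false|.
Proof.
case/set0Pn=> i iS; case: splitA => _ _ dimA _ _.
(* [T c] collects the faces with a free coordinate in [S], which are split evenly between the two
   parities. *)
pose T c := \sum_(a in A | ~~ (S \subset beta a)) #|[set x | in_face a x && (parity S x == c)]|.
have TE : T true = T false.
  by apply: eq_bigr => a /andP[_ /subsetPn[j jS ja]]; rewrite (parity_balanced _ jS ja).
have E c : #|[set x : point n | parity S x == c]| = #|parity_class S c| * 2 ^ (n - 5) + T c.
  rewrite splitting_card (bigID (fun a => S \subset beta a)) /=; congr (_ + _).
  rewrite -sum_nat_const big_mkcond [RHS]big_mkcond; apply: eq_bigr => a _.
  rewrite !inE; case aA: (a \in A) => //=; case: (boolP (S \subset beta a)) => //= Sa.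
  case: eqP => [<-|neq].
    rewrite -(eqP (dimA a aA)) -card_face; apply: eq_card => x; rewrite !inE.
    by case ax: (in_face a x) => //=; rewrite (parity_in_face Sa ax) eqxx.
  apply/eqP; rewrite cards_eq0; apply/eqP/setP=> x; rewrite !inE.
  by apply/negP=> /andP[ax /eqP]; rewrite (parity_in_face Sa ax).
(* The whole cube is the face without fixed entries. *)
have EB : #|[set x : point n | parity S x == true]| = #|[set x : point n | parity S x == false]|.
  have := @parity_balanced n [ffun=> None] S i true iS; rewrite inE ffunE => /(_ isT).
  have in_all x : in_face [ffun=> None] x by apply/forallP=> j; rewrite ffunE.
  have F c : [set x | in_face [ffun=> None] x && (parity S x == c)] = [set x | parity S x == c].
    by apply/setP=> x; rewrite !inE in_all.
  by rewrite !F.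
move: EB; rewrite !E TE => /eqP; rewrite eqn_add2r eqn_pmul2r ?expn_gt0 //.
by move/eqP.
Qed.

(** Were the antipode missing, [a] would be the only face whose base contains [beta a], and a single
    face cannot be balanced. *)
Lemma antipode_in a : a \in A -> antipode a \in A.
Proof.
move=> aA; case: splitA => _ _ _ _ antA; apply/negPn/negP=> naA.
have only b : b \in A -> beta a \subset beta b -> b = a.
  move=> bA ab; apply/eqP/negPn/negP=> nba.
  have Eab : beta a == beta b by rewrite eqEcard ab !card_beta.
  have : antipodal a b.
    by apply: antA => //; rewrite 1?eq_sym // /parallel !direction_beta (eqP Eab).
  by move/antipodalE => Eb; move: naA; rewrite -Eb bA.
have bn : beta a != set0 by rewrite -card_gt0 card_beta.
have := faces_balanced bn.
have E c : parity_class (beta a) c = if face_parity (beta a) a == c then [set a] else set0.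
  apply/setP=> b; rewrite (fun_if (fun X : {set _} => b \in X)) !inE.
  have [bA|nbA] /= := boolP (b \in A); last first.
    have /negPf nba : b != a by apply: contraNneq nbA => ->.
    by rewrite nba if_same.
  case: (boolP (_ \subset _)) => [ab|nab] /=.
    by rewrite (only b bA ab) eqxx; case: eqP.
  have /negPf nba : b != a by apply: contraNneq nab => ->.
  by rewrite nba if_same.
by rewrite !E; case: face_parity; rewrite /= cards1 cards0.
Qed.

Lemma antipode_neq a : a \in A -> antipode a != a.
Proof.
move=> /card_beta ca; apply/eqP=> E.
have /card_gt0P [i] : 0 < #|beta a| by rewrite ca.
by rewrite inE; move/ffunP/(_ i): E; rewrite ffunE; case: (a i) => [[]|].
Qed.

Lemma beta_eq a b : a \in A -> b \in A -> beta a = beta b -> b = a \/ b = antipode a.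
Proof.
move=> aA bA E; have [->|nab] := eqVneq b a; [by left|right].
case: splitA => _ _ _ _ antA; apply: antipodalE; apply: antA => //.
  by rewrite eq_sym.
by rewrite /parallel !direction_beta E.
Qed.

(** Each base belongs to exactly two faces, an antipodal pair. *)
Lemma card_betaA : #|betaA A| = 16.
Proof.
case: splitA => _ cardA _ _ _.
suff : 16 * 2 = #|betaA A| * 2 by move/eqP; rewrite eqn_pmul2r // => /eqP.
have <- : #|A| = 16 * 2 by rewrite cardA.
rewrite -sum1_card (partition_big_imset (@beta n)) /= -sum_nat_const.
apply: eq_bigr => U /imsetP[a aA ->].
rewrite (bigD1 a) ?aA ?eqxx //= (bigD1 (antipode a)) /=; last first.
  by rewrite antipode_in // beta_antipode eqxx antipode_neq.
rewrite big1 // => b /andP[/andP[/andP[bA /eqP bb] ba] bb'].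
by case: (beta_eq aA bA) ba bb' => // ->; rewrite eqxx.
Qed.

Lemma faces_differ a b : a \in A -> b \in A -> a != b ->
  exists i v, a i = Some v /\ b i = Some (~~ v).
Proof.
move=> aA bA nab.
case: (boolP [exists i, if a i is Some v then b i == Some (~~ v) else false]).
  case/existsP=> i; case E: (a i) => [v|//] /eqP Eb; by exists i, v.
(* [x] follows [a], then [b]; if they never differ it lies in both. Its value where both are free is
   arbitrary. *)
move/existsPn=> H; pose x : point n := [ffun i => if a i is Some v then v else if b i is Some v then v else true].
have ax : in_face a x by apply/in_faceP=> i v E; rewrite ffunE E.
have bx : in_face b x.
  apply/in_faceP=> i v E; rewrite ffunE E; move: (H i); rewrite E.
  by case: (a i) => // -[]; case: v {E}.
have := splitting_partition x; rewrite (cardsD1 a) inE aA ax.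
by rewrite (cardsD1 b) !inE bA bx eq_sym nab.
Qed.

(** A difference between [b] and the antipode of [a] is an agreement of [b] with [a]. *)
Lemma faces_agree a b : a \in A -> b \in A -> beta a != beta b ->
  exists i v, a i = Some v /\ b i = Some v.
Proof.
move=> aA bA nab; have nab' : antipode a != b.
  by apply: contraNneq nab => <-; rewrite beta_antipode.
have [i [v []]] := faces_differ (antipode_in aA) bA nab'.
by rewrite ffunE; case E: (a i) => [w|] //= [<-]; rewrite negbK; exists i, w.
Qed.

End Splitting.

Lemma uniq_map_inj (T1 T2 : eqType) (f : T1 -> T2) (s : seq T1) :
  uniq (map f s) -> {in s &, injective f}.
Proof.
elim: s => //= x s IH /andP[fx us] y z; rewrite !inE.
case/predU1P=> [->|ys] /predU1P[->|zs] E //; last exact: IH.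
  by rewrite E map_f in fx.
by rewrite -E map_f in fx.
Qed.

(** * Subfamilies with at most one face from each antipodal pair *)

Section Subfamilies.
Variables (n : nat) (A : {set face n}).
Hypothesis splitA : antipodal_splitting 5 A.
Implicit Types (a b : face n) (B : seq (face n)) (S : {set 'I_n}).

Definition count_parity S c B :=
  count (fun b => (S \subset beta b) && (face_parity S b == c)) B.

(** As [#|S|] is even, antipodes have the same sign on [S]. Without a new face, the class of sign
    [~~ c] would consist of faces of [B] and their antipodes, hence be smaller than the class of
    sign [c], against the balance of [A]. *)
Lemma new_face B S c : {subset B <= A} -> uniq (map (@beta n) B) -> #|S| = 4 ->
  count_parity S (~~ c) B < count_parity S c B ->
  exists2 a, a \in A &
    [/\ S \subset beta a, face_parity S a = ~~ c & beta a \notin map (@beta n) B].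
Proof.
move=> BA uB cS lt_count.
case: (boolP [exists a in A, [&& S \subset beta a, face_parity S a == ~~ c
                               & beta a \notin map (@beta n) B]]).
  by case/exists_inP=> a aA /and3P[Sa /eqP pa ba]; exists a.
move/exists_inPn=> none.
pose P c0 b := (S \subset beta b) && (face_parity S b == c0).
have antiP c0 b : P c0 (antipode b) = P c0 b.
  rewrite /P beta_antipode; case: (boolP (S \subset beta b)) => //= Sb.
  by rewrite face_parity_antipode // cS.
have leC : #|parity_class A S (~~ c)| <= (count_parity S (~~ c) B).*2.
  pose Bn := filter (P (~~ c)) B.
  have -> : (count_parity S (~~ c) B).*2 = size (Bn ++ map (@antipode n) Bn).
    by rewrite size_cat size_map addnn size_filter.
  rewrite cardE; apply: uniq_leq_size (enum_uniq _) _ => a.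
  rewrite mem_enum inE => /and3P[aA Sa pa].
  have := none a aA; rewrite Sa pa /= negbK => /mapP[b bB Eb].
  have [E|E] := beta_eq splitA aA (BA b bB) Eb.
    by rewrite mem_cat mem_filter /P Sa pa -E bB.
  rewrite mem_cat; apply/orP; right; apply/mapP; exists b; last by rewrite E antipodeK.
  by rewrite mem_filter bB E antiP /P Sa pa.
have geC : (count_parity S c B).*2 <= #|parity_class A S c|.
  pose Bp := filter (P c) B.
  have -> : (count_parity S c B).*2 = size (Bp ++ map (@antipode n) Bp).
    by rewrite size_cat size_map addnn size_filter.
  have uBp : uniq Bp by rewrite filter_uniq // (map_uniq uB).
  rewrite cardE; apply: uniq_leq_size.
    rewrite cat_uniq uBp (map_inj_uniq (inv_inj (@antipodeK n))) uBp andbT /=.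
    apply/hasPn=> _ /mapP[b + ->]; rewrite mem_filter => /andP[_ bB].
    rewrite mem_filter; apply/negP=> /andP[_ b'B].
    have := antipode_neq splitA (BA b bB); apply/negP; rewrite negbK.
    by apply/eqP/(uniq_map_inj uB) => //; rewrite beta_antipode.
  move=> a; rewrite mem_enum inE mem_cat => /orP[|/mapP[b]].
    by rewrite mem_filter => /andP[Pa /BA ->].
  rewrite mem_filter => /andP[Pb /BA bA] ->.
  by rewrite antipode_in //; rewrite -(antiP c b) in Pb.
have Sn0 : S != set0 by rewrite -card_gt0 cS.
have := faces_balanced splitA Sn0.
move: lt_count; rewrite -ltn_double => /(leq_ltn_trans leC) /leq_trans/(_ geC).
by case: c {none leC geC} => /= lt E; rewrite E ltnn in lt.
Qed.

Lemma size_subfamily B : {subset B <= A} -> uniq (map (@beta n) B) -> size B <= 16.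
Proof.
move=> BA uB; rewrite -(card_betaA splitA) cardE -(size_map (@beta n)).
apply: uniq_leq_size => // _ /mapP[b /BA bA ->].
by rewrite mem_enum; apply: imset_f.
Qed.

(* Each 4-subset of the base of a face outside a balanced subfamily lies in the
   base of a further face, and these five bases are distinct. *)
Lemma balanced_subfamily B : {subset B <= A} -> uniq (map (@beta n) B) ->
  (forall S c, #|S| = 4 -> count_parity S c B <= count_parity S (~~ c) B) ->
  10 < size B -> size B = 16.
Proof.
move=> BA uB bal gt10; apply/eqP; rewrite eqn_leq size_subfamily //= leqNgt.
apply/negP=> lt16.
have [U UA UB] : exists2 U, U \in betaA A & U \notin map (@beta n) B.
  apply/exists_inP; case: exists_inP => // none; move: lt16.
  rewrite -(card_betaA splitA) cardE -(size_map (@beta n)) ltnNge => /negP; case.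
  apply: uniq_leq_size (enum_uniq _) _ => U; rewrite mem_enum => UA.
  by apply/negPn/negP=> UB; apply: none; exists U.
case/imsetP: UA UB => a aA -> aB {U}.
pose N := [set U in betaA A | (U \notin map (@beta n) B) && (U != beta a)].
have uaB : uniq (map (@beta n) (a :: B)) by rewrite /= aB.
have aBA : {subset a :: B <= A} by move=> b; rewrite inE => /predU1P[->|/BA].
have N5 : 5 <= #|N|.
  (* A base that meets [beta a] in [beta a :\ i] yields the singleton of [i] as difference; hence
     [N] has at least as many members as [beta a]. *)
  rewrite -(card_beta splitA aA) -(card_imset _ (@set1_inj _)).
  apply: leq_trans (leq_imset_card (fun U => beta a :\: U) _).
  apply: subset_leq_card; apply/subsetP=> _ /imsetP[i ia ->].
  pose S := beta a :\ i.
  have cS : #|S| = 4.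
    by have := cardsD1 i (beta a); rewrite ia (card_beta splitA aA) => -[].
  have Sa : S \subset beta a by apply: subsetDl.
  (* [B] is balanced at [S], so adding [a] tips the count towards the sign of [a]. *)
  have lt : count_parity S (~~ face_parity S a) (a :: B)
            < count_parity S (face_parity S a) (a :: B).
    rewrite /count_parity /= Sa eqxx /=.
    have -> : (face_parity S a == ~~ face_parity S a) = false by case: face_parity.
    rewrite ltnS add0n -{2}(negbK (face_parity S a)); exact: bal.
  have [b bA [Sb _]] := new_face aBA uaB cS lt; rewrite inE negb_or => /andP[bna bB].
  have ib : i \notin beta b.
    apply: contraNN bna => ib; rewrite eq_sym eqEcard !(card_beta splitA) // leqnn andbT.
    by rewrite -(setD1K ia) subUset sub1set ib.
  apply/imsetP; exists (beta b); first by rewrite inE imset_f // bna bB.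
  apply/setP=> j; rewrite !inE; case: eqP => [->|/eqP ji].
    by move: ib ia; rewrite !inE => -> ->.
  apply/esym/negP=> /andP[jb ja]; have : j \in S by rewrite !inE ji.
  by move/(subsetP Sb); rewrite inE (negPf jb).
have : size (enum N ++ map (@beta n) (a :: B)) <= #|betaA A|.
  rewrite [X in _ <= X]cardE; apply: uniq_leq_size.
    rewrite cat_uniq enum_uniq uaB andbT; apply/hasPn=> U UaB.
    rewrite mem_enum inE; move: UaB; rewrite inE => /predU1P[->|->].
      by rewrite eqxx !andbF.
    by rewrite andbF.
  move=> U; rewrite mem_cat !mem_enum inE => /orP[/andP[]//|/mapP[b /aBA bA ->]].
  exact: imset_f.
rewrite size_cat size_map -cardE card_betaA //= => le16.
(* Five bases in [N], that of [a] and at least eleven from [B] would make seventeen. *)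
have le12 : 12 <= (size B).+1 by [].
by have := leq_trans (leq_add N5 le12) le16.
Qed.

End Subfamilies.

(** * Patterns and the tree of forced extensions *)

Notation pattern := (seq (option bool)).

(* [all] and [has] evaluate all their tests under call by value. *)
Fixpoint lazy_all (T : Type) (P : T -> bool) (s : seq T) : bool :=
  if s is x :: s' then if P x then lazy_all P s' else false else true.

Fixpoint lazy_has (T : Type) (P : T -> bool) (s : seq T) : bool :=
  if s is x :: s' then if P x then true else lazy_has P s' else false.

Lemma lazy_allE (T : Type) (P : T -> bool) s : lazy_all P s = all P s.
Proof. by elim: s => //= x s ->. Qed.

Lemma lazy_hasE (T : Type) (P : T -> bool) s : lazy_has P s = has P s.
Proof. by elim: s => //= x s ->. Qed.

(* The flags record a coordinate of agreement, one of difference, and one lying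
   in exactly one of the two supports. *)
Fixpoint compat_rec (u d s : bool) (g h : pattern) : bool :=
  match g, h with
  | x :: g', y :: h' =>
      match x, y with
      | Some b, Some c =>
          if b (+) c then compat_rec u true s g' h' else compat_rec true d s g' h'
      | None, None => compat_rec u d s g' h'
      | _, _ => compat_rec u d true g' h'
      end
  | _, _ => if u then if d then s else false else false
  end.

Definition compat := compat_rec false false false.

(* Some completion of [q0] by one entry may be incompatible with [h]. *)
Fixpoint unsettled (u d s : bool) (q0 h : pattern) : bool :=
  match q0, h with
  | x :: q', y :: h' =>
      match x, y with
      | Some b, Some c =>
          if b (+) c then unsettled u true s q' h' else unsettled true d s q' h'
      | Some _, None => unsettled u d true q' h'
      | _, _ => unsettled u d s q' h'
      end
  | _, _ => if u then if d then ~~ s else true else true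
  end.

(* The parity of the number of differences on the support of [p], provided that
   it is contained in the support of [h]. *)
Fixpoint difference_parity (acc : bool) (p h : pattern) : option bool :=
  match p, h with
  | x :: p', y :: h' =>
      match x, y with
      | None, _ => difference_parity acc p' h'
      | Some _, None => None
      | Some b, Some c => difference_parity (if b (+) c then ~~ acc else acc) p' h'
      end
  | _, _ => Some acc
  end.

(** [drops] yields the 4-subsets at which balance is tested, [flips] the entries of a forced face on
    such a subset, [fills] its fifth fixed entry. *)
Fixpoint drops (g : pattern) : seq pattern :=
  if g is x :: g' then
    let r := map (cons x) (drops g') in
    if x is Some _ then (None :: g') :: r else r
  else [::].

Fixpoint flips (g : pattern) : seq pattern :=
  if g is x :: g' then
    let r := map (cons x) (flips g') in
    if x is Some b then (Some (~~ b) :: g') :: r else r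
  else [::].

Fixpoint fills (g : pattern) : seq pattern :=
  if g is x :: g' then
    let r := map (cons x) (fills g') in
    if x is Some _ then r else [:: Some true :: g', Some false :: g' & r]
  else [::].

(** An even number of differences from [p] means the same sign as [p] on its support; the test asks
    whether this sign prevails. *)
Definition excess (L : seq pattern) (p : pattern) : bool :=
  let r := map (difference_parity false p) L in
  count (fun x => if x is Some true then true else false) r
  < count (fun x => if x is Some false then true else false) r.

(** The fifth coordinate is an old one, or a new one put in front, with sign chosen to read true. In
    the latter case the supports surely differ, whence the flag [true]. Testing only against [M] can
    only keep more children. *)
Definition extensions (L : seq pattern) (q0 : pattern) : seq (seq pattern) :=
  let M := filter (unsettled false false false q0) L in
  let old := [seq q :: L | q <- fills q0 & lazy_all (compat q) M] in
  if lazy_all (compat_rec false false true q0) M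
  then ((Some true :: q0) :: map (cons None) L) :: old else old.

Definition children (L : seq pattern) (p : pattern) : seq (seq pattern) :=
  flatten (map (extensions L) (flips p)).

(* Every pattern in excess would do; one with few children keeps the tree small. *)
Fixpoint branching (L : seq pattern) (ps : seq pattern) (best : option (seq (seq pattern))) :=
  if ps is p :: ps' then
    if excess L p then
      let c := children L p in
      if size c <= 3 then Some c else
      branching L ps' (if best is Some c' then
                      if size c < size c' then Some c else best
                    else Some c)
    else branching L ps' best
  else best.

(** * Faces encoded as patterns *)

Section Encoding.
Variable n : nat.
Implicit Types (a b p : face n) (B : seq (face n)) (S : {set 'I_n}) (i j : 'I_n)
  (phi : seq 'I_n) (eps : 'I_n -> bool).

(** [phi] chooses and orders the recorded coordinates, and [eps i] tells whether the two values at
    [i] are exchanged: these are the symmetries the search normalises by. *)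
Definition encode phi eps a : pattern := [seq omap (addb (eps i)) (a i) | i <- phi].

Definition update a i v : face n := [ffun j => if j == i then v else a j].

Lemma eq_encode phi eps eps' a b : {in phi, eps =1 eps'} -> {in phi, a =1 b} ->
  encode phi eps a = encode phi eps' b.
Proof. by move=> Ee Ea; apply/eq_in_map => i iphi; rewrite Ee ?Ea. Qed.

Lemma encode_update_notin phi eps a i v : i \notin phi ->
  encode phi eps (update a i v) = encode phi eps a.
Proof.
move=> iphi; apply: eq_encode => // j jphi; rewrite ffunE.
by case: eqP jphi iphi => // -> ->.
Qed.

(** The signs [eps] cancel when two entries at the same coordinate are compared. *)
Lemma compat_rec_encode phi eps a b u d s :
  compat_rec u d s (encode phi eps a) (encode phi eps b) =
  [&& u || has (fun i => (a i != None) && (a i == b i)) phi,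
      d || has (fun i => [&& a i != None, b i != None & a i != b i]) phi
    & s || has (fun i => (a i == None) != (b i == None)) phi].
Proof.
elim: phi u d s => [|i phi IH] u d s /=; first by rewrite !orbF; case: u; case: d.
case: (a i) => [v|] /=; case: (b i) => [w|] /=; rewrite ?IH ?orbT //.
case: (eps i) v w => -[] [] /=; by rewrite ?IH /= ?orbT.
Qed.

Lemma difference_parity_encode phi eps p b acc :
  difference_parity acc (encode phi eps p) (encode phi eps b) =
  if all (fun i => (p i == None) || (b i != None)) phi
  then Some (acc (+) odd (count (fun i => (p i != None) && (p i != b i)) phi)) else None.
Proof.
elim: phi acc => [|i phi IH] acc /=; first by rewrite addbF.
case: (p i) => [v|] /=; case: (b i) => [w|] //=; rewrite IH; case: all => //=.
  congr Some; rewrite oddD oddb.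
  by case: (eps i) v w acc => -[] [] [] //=; rewrite ?negbK.
Qed.

Lemma dropsP phi eps a (q : pattern) : uniq phi ->
  reflect (exists2 i, i \in phi & a i != None /\ q = encode phi eps (update a i None))
          (q \in drops (encode phi eps a)).
Proof.
move=> uphi; apply: (iffP idP) => [|[i + [+ ->]]].
  elim: phi q uphi => [|i phi IH] q //= /andP[iphi uphi].
  have tail : q \in map (cons (omap (addb (eps i)) (a i))) (drops (encode phi eps a)) ->
    exists2 j, j \in i :: phi &
      a j != None /\ q = omap (addb (eps i)) (update a j None i) :: encode phi eps (update a j None).
    case/mapP=> r /(IH _ uphi)[j jphi [aj ->]] ->; exists j; first by rewrite inE jphi orbT.
    by split=> //; rewrite ffunE; case: eqP jphi iphi => // -> ->.
  case E: (a i) tail => [v|] //= tail; rewrite inE => /predU1P[->|/tail //].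
  exists i; first exact: mem_head.
  by rewrite E ffunE eqxx encode_update_notin.
elim: phi uphi => [|j phi IH] //= /andP[jphi uphi]; rewrite inE => /predU1P[->|iphi] ai.
  rewrite ffunE eqxx encode_update_notin //=.
  by case: (a j) ai => // v _; rewrite mem_head.
have ji : j == i = false by apply/negP=> /eqP E; rewrite E iphi in jphi.
rewrite ffunE ji; have Q := map_f (cons (omap (addb (eps j)) (a j))) (IH uphi iphi ai).
by case: (a j) Q => //= v Q; rewrite inE Q orbT.
Qed.

Lemma mem_flips phi eps a i v : uniq phi -> i \in phi -> a i = Some v ->
  encode phi eps (update a i (Some (~~ v))) \in flips (encode phi eps a).
Proof.
elim: phi => [|j phi IH] //= /andP[jphi uphi]; rewrite inE => /predU1P[->|iphi] ai.
  by rewrite ai ffunE eqxx encode_update_notin //= addbN mem_head.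
have ji : j == i = false by apply/negP=> /eqP E; rewrite E iphi in jphi.
rewrite ffunE ji; have Q := map_f (cons (omap (addb (eps j)) (a j))) (IH uphi iphi ai).
by case: (a j) Q => //= w Q; rewrite inE Q orbT.
Qed.

Lemma mem_fills phi eps a i v : uniq phi -> i \in phi -> a i = None ->
  encode phi eps (update a i (Some v)) \in fills (encode phi eps a).
Proof.
elim: phi => [|j phi IH] //= /andP[jphi uphi]; rewrite inE => /predU1P[->|iphi] ai.
  rewrite ai ffunE eqxx encode_update_notin //= !inE.
  by case: (_ (+) _); rewrite eqxx ?orbT.
have ji : j == i = false by apply/negP=> /eqP E; rewrite E iphi in jphi.
rewrite ffunE ji; have Q := map_f (cons (omap (addb (eps j)) (a j))) (IH uphi iphi ai).
by case: (a j) Q => //= Q; rewrite !inE Q !orbT.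
Qed.

(** The differences form the symmetric difference of the sets of true coordinates, whose size is
    congruent mod 2 to the sum of the two sizes. *)
Lemma count_difference p b phi : uniq phi -> {subset beta p <= phi} -> beta p \subset beta b ->
  odd (count (fun i => (p i != None) && (p i != b i)) phi) =
  face_parity (beta p) p (+) face_parity (beta p) b.
Proof.
move=> uphi sub /subsetP pb.
rewrite -size_filter -(card_uniqP (filter_uniq _ uphi)) /face_parity.
set X := [set i in beta p | p i == _]; set Y := [set i in beta p | b i == _].
have -> : #|[seq i <- phi | (p i != None) && (p i != b i)]| = #|(X :\: Y) :|: (Y :\: X)|.
  apply: eq_card => i; rewrite mem_filter !inE.
  move: (sub i) (pb i); rewrite !inE.
  case: (p i) => [v|] //= /(_ isT) -> /(_ isT); rewrite andbT.
  by case: (b i) v => [[]|] // [].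
rewrite cardsU (_ : _ :&: _ = set0) ?cards0 ?subn0; last first.
  by apply/setP=> i; rewrite !inE; case: (p i == _); case: (b i == _); rewrite ?andbF.
rewrite -(cardsID Y X) -[in #|Y|](cardsID X Y) !oddD setIC.
by case: odd; case: odd; case: odd.
Qed.

Lemma excess_encode phi eps B p : uniq phi -> {subset beta p <= phi} ->
  excess (map (encode phi eps) B) (encode phi eps p) =
  (count_parity (beta p) (~~ face_parity (beta p) p) B <
   count_parity (beta p) (face_parity (beta p) p) B).
Proof.
move=> uphi sub; rewrite /excess -map_comp !count_map.
have E b : difference_parity false (encode phi eps p) (encode phi eps b) =
  if beta p \subset beta b
  then Some (face_parity (beta p) p (+) face_parity (beta p) b) else None.
  rewrite difference_parity_encode.
  have -> : all (fun i => (p i == None) || (b i != None)) phi = (beta p \subset beta b).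
    apply/allP/subsetP => [H i ip|H i _].
      by move: ip (H i (sub i ip)); rewrite !inE; case: (p i).
    by move: (H i); rewrite !inE; case: (p i) => //= v /(_ isT).
  by case: (boolP (_ \subset _)) => // pb; rewrite count_difference.
by congr (_ < _); apply: eq_count => b /=; rewrite E; case: (_ \subset _) => //=;
   case: face_parity; case: face_parity.
Qed.

End Encoding.

(** Whichever candidate is preferred, it comes from a pattern in excess, and soundness uses only
    this. *)
Lemma branching_Some (L ps : seq pattern) best cs : branching L ps best = Some cs ->
  best = Some cs \/ exists2 p, p \in ps & excess L p /\ cs = children L p.
Proof.
elim: ps best => [|p ps IH] best /=; first by left.
have step best' : branching L ps best' = Some cs ->
    best' = best \/ best' = Some (children L p) /\ excess L p ->
    best = Some cs \/ exists2 q, q \in p :: ps & excess L q /\ cs = children L q.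
  case/IH=> [->|[q qps Eq] _]; last by right; exists q; rewrite // inE qps orbT.
  by case=> [<-|[[->] ex]]; [left|right; exists p; rewrite ?mem_head].
case: ifP => [ex|_]; last by move/step; apply; left.
case: ifP => [_ [<-]|_]; first by right; exists p; rewrite ?mem_head.
move/step; apply; case: best {step} => [c|]; last by right.
by case: ifP => _; [right|left].
Qed.

(** An excess met along the way always leaves a candidate, so [None] certifies that there is
    none. *)
Lemma branching_None (L ps : seq pattern) best : branching L ps best = None ->
  best = None /\ {in ps, forall p, excess L p = false}.
Proof.
elim: ps best => [|p ps IH] best //=.
case: ifP => [ex|nex].
  by case: ifP => // _ /IH[]; case: best => // c; case: ifP.
by move=> /IH[-> H]; split=> // q; rewrite inE => /predU1P[->|/H].
Qed.

(** * Every forced face occurs among the children *)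

Section Realization.
Variables (n : nat) (A : {set face n}).
Hypothesis splitA : antipodal_splitting 5 A.
Implicit Types (a b p : face n) (B : seq (face n)) (S : {set 'I_n}) (i j : 'I_n)
  (phi : seq 'I_n) (eps : 'I_n -> bool).

(** [L] is what the search sees of [B], and [phi] contains all coordinates fixed in [B]. *)
Definition realization phi eps B (L : seq pattern) :=
  [/\ uniq phi, {subset B <= A}, uniq (map (@beta n) B),
      {in B, forall b, {subset beta b <= phi}} & L = map (encode phi eps) B].

Definition realizable L := exists phi eps B, realization phi eps B L.

Lemma beta_update_None a i : beta (update a i None) = beta a :\ i.
Proof. by apply/setP=> j; rewrite !inE ffunE; case: (j == i). Qed.

(* Among the four entries an odd number, one or three, disagree; passing to the
   antipode turns three into one. *)
Lemma one_flip p a : #|beta p| = 4 -> beta p \subset beta a ->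
  face_parity (beta p) a = ~~ face_parity (beta p) p ->
  exists i v, exists2 a', a' = a \/ a' = antipode a &
    p i = Some v /\ {in beta p, a' =1 update p i (Some (~~ v))}.
Proof.
move=> cp pa par.
have : odd #|[set i in beta p | p i != a i]|.
  have sub : {subset beta p <= enum (beta p)} by move=> i; rewrite mem_enum.
  have : odd (count (fun i => (p i != None) && (p i != a i)) (enum (beta p))).
    by rewrite (count_difference (enum_uniq _) sub pa) par addbN addbb.
  rewrite -size_filter -(card_uniqP (filter_uniq _ (enum_uniq _))).
  congr (is_true (odd _)); apply: eq_card => i; rewrite !(inE, mem_filter, mem_enum).
  by case: (p i == None); rewrite ?andbT ?andbF.
pose X := [set i in beta p | p i != a i].
pose Y := [set i in beta p | p i != antipode a i].
have cXY : #|X| + #|Y| = 4.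
  rewrite -cp -(cardsID X (beta p)); congr (_ + _); apply: eq_card => i.
    by rewrite !inE; case: (p i).
  rewrite !inE ffunE; have := subsetP pa i; rewrite !inE.
  by case: (p i) => //= v /(_ isT); case: (a i) v => // -[] [].
have main a' : #|[set i in beta p | p i != a' i]| = 1 -> beta p \subset beta a' ->
    exists i v, p i = Some v /\ {in beta p, a' =1 update p i (Some (~~ v))}.
  move/eqP/cards1P => [i /setP Ei] pa'.
  have := Ei i; rewrite !inE eqxx; case pv: (p i) => [v|] //= ai.
  exists i, v; split=> // j jp; rewrite ffunE; case: (eqVneq j i) => [->|ji].
    have : i \in beta a' by apply: (subsetP pa'); rewrite inE pv.
    by rewrite inE; move: ai; case: (a' i) v {pv} => [[]|] // [].
  by have := Ei j; rewrite !inE (negPf ji); move: jp; rewrite inE => -> /negbFE/eqP.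
rewrite -/X => oX; have [cX|cY] : #|X| = 1 \/ #|Y| = 1.
  move: cXY oX; case: #|X| => [|[|[|[|[|k]]]]] //; first by left.
  by rewrite !addSn => -[E] _; right.
  have [i [v E]] := main _ cX pa; exists i, v; exists a => //; by left.
have [|i [v E]] := main _ cY; first by rewrite beta_antipode.
by exists i, v; exists (antipode a) => //; right.
Qed.

(** Balance of [A] at [beta p] forces a new face; up to antipode it is [p] with one fixed entry
    flipped and one free entry [j] filled. Either [j] is in [phi] or it opens a new position. *)
Lemma children_complete phi eps B L p : realization phi eps B L ->
  #|beta p| = 4 -> {subset beta p <= phi} -> excess L (encode phi eps p) ->
  exists2 L', L' \in children L (encode phi eps p) & realizable L'.
Proof.
case=> uphi BA uB Bphi ->; set L0 := map _ B => cp pphi; rewrite excess_encode // => ex.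
have [a0 a0A [pa0 para0 a0B]] := new_face splitA BA uB cp ex.
have [i [v [a aa0 [pv pa]]]] := one_flip cp pa0 para0.
have ba : beta a = beta a0 by case: aa0 => ->; rewrite ?beta_antipode.
have aA : a \in A by case: aa0 => ->; rewrite ?antipode_in.
have {a0 a0A pa0 para0 a0B aa0 ba} aB : beta a \notin map (@beta n) B by rewrite ba.
set q0 := update p i (Some (~~ v)) in pa.
have ip : i \in beta p by rewrite inE pv.
have bq0 : beta q0 = beta p.
  by apply/setP=> j; rewrite !inE ffunE; case: (eqVneq j i) => // ->; rewrite pv.
have suba : beta p \subset beta a.
  by apply/subsetP=> j jp; rewrite inE (pa j jp); move: jp; rewrite -bq0 inE.
have [j Ej] : exists j, beta a :\: beta p = [set j].
  by apply/cards1P; rewrite cardsD (setIidPr suba) (card_beta splitA aA) cp.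
have [jp ja] : j \notin beta p /\ j \in beta a.
  by apply/andP; rewrite -in_setD Ej set11.
have aE : a = update q0 j (a j).
  apply/ffunP=> k; rewrite ffunE; case: (eqVneq k j) => [->//|kj].
  have [kp|kp] := boolP (k \in beta p); first exact: pa.
  have : k \notin beta a :\: beta p by rewrite Ej inE.
  rewrite in_setD kp /= inE negbK => /eqP ->.
  by move: kp; rewrite -bq0 inE negbK => /eqP.
case aj: (a j) ja => [w|]; last by rewrite inE aj.
move=> ja; have q0j : q0 j = None by move: jp; rewrite -bq0 inE negbK => /eqP.
have q0f : encode phi eps q0 \in flips (encode phi eps p).
  by apply: mem_flips => //; apply: pphi.
have distinct b : b \in B -> [/\ beta a != beta b, a != b & b \in A].
  move=> bB; split; last exact: BA.
    by apply: contraNneq aB => ->; apply: map_f.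
  by apply: contraNneq aB => ->; apply: map_f.
have agree b : b \in B -> has (fun i => (a i != None) && (a i == b i)) phi.
  move=> bB; have [nab _ bA] := distinct b bB.
  have [k [u [ak bk]]] := faces_agree splitA aA bA nab; apply/hasP; exists k.
    by apply: (Bphi b bB); rewrite inE bk.
  by rewrite ak bk eqxx.
have differ b : b \in B -> has (fun i => [&& a i != None, b i != None & a i != b i]) phi.
  move=> bB; have [_ nab bA] := distinct b bB.
  have [k [u [ak bk]]] := faces_differ splitA aA bA nab; apply/hasP; exists k.
    by apply: (Bphi b bB); rewrite inE bk.
  by rewrite ak bk; case: u {ak bk}.
have aBA : {subset a :: B <= A} by move=> b; rewrite inE => /predU1P[->|/BA].
have uaB : uniq (map (@beta n) (a :: B)) by rewrite /= aB.
have [jphi|jphi] := boolP (j \in phi).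
  have aphi : {subset beta a <= phi}.
    move=> k ka; have [/pphi//|kp] := boolP (k \in beta p).
    have : k \in beta a :\: beta p by rewrite in_setD kp.
    by rewrite Ej inE => /eqP ->.
  exists (encode phi eps a :: L0); last first.
    exists phi, eps, (a :: B); split=> //.
    by move=> b; rewrite inE => /predU1P[->|/Bphi].
  apply/flattenP; exists (extensions L0 (encode phi eps q0)); first exact: map_f.
  have : encode phi eps a :: L0 \in
    [seq q :: L0 | q <- fills (encode phi eps q0)
       & lazy_all (compat q) (filter (unsettled false false false (encode phi eps q0)) L0)].
    apply: map_f; rewrite mem_filter; apply/andP; split; last first.
      by rewrite [in encode phi eps a]aE aj; apply: mem_fills.
    rewrite lazy_allE; apply/allP=> g; rewrite mem_filter => /andP[_ /mapP[b bB ->]].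
    rewrite /compat compat_rec_encode /= agree // differ //=.
    have [nab _ _] := distinct b bB; apply/negPn/negP=> /hasPn none.
    case/eqP: nab; apply/setP=> k; rewrite !inE; apply/idP/idP.
      move=> ak; have kphi : k \in phi by apply: aphi; rewrite inE.
      by move: (none k kphi); rewrite negbK (negPf ak) => /eqP <-.
    move=> bk; have kphi : k \in phi by apply: (Bphi b bB); rewrite inE.
    by move: (none k kphi); rewrite negbK (negPf bk) => /eqP ->.
  by rewrite /extensions; case: ifP => // _ H; rewrite inE H orbT.
(* The sign of the new coordinate is chosen so that its entry [w] is encoded as true. *)
pose eps' k := if k == j then ~~ w else eps k.
have nj k : k \in phi -> k == j = false.
  by move=> kphi; apply/negP=> /eqP E; rewrite E (negPf jphi) in kphi.
have eps'E : {in phi, eps' =1 eps} by move=> k /nj; rewrite /eps' => ->.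
have aq0 : {in phi, a =1 q0} by move=> k /nj kj; rewrite [a]aE ffunE kj.
exists ((Some true :: encode phi eps q0) :: map (cons None) L0); last first.
  exists (j :: phi), eps', (a :: B); split=> //=.
  - by rewrite jphi.
  - move=> b; rewrite inE => /predU1P[->|bB] k kb; rewrite inE; last by rewrite (Bphi b bB) ?orbT.
    have [/pphi->|kp] := boolP (k \in beta p); first by rewrite orbT.
    have : k \in beta a :\: beta p by rewrite in_setD kp.
    by rewrite Ej inE => ->.
  - congr (_ :: _).
      by rewrite aj /= /eps' eqxx (eq_encode eps'E aq0); case: w {eps' eps'E aj}.
    rewrite -map_comp; apply/eq_in_map => b bB /=.
    rewrite (eq_encode (b := b) eps'E) //; congr (_ :: _).
    by case E: (b j) => [u|] //; move: jphi; rewrite (Bphi b bB) // inE E.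
apply/flattenP; exists (extensions L0 (encode phi eps q0)); first exact: map_f.
rewrite /extensions ifT ?mem_head // lazy_allE; apply/allP=> g.
rewrite mem_filter => /andP[_ /mapP[b bB ->]].
rewrite -(eq_encode (fun _ _ => erefl) aq0) compat_rec_encode /=.
by rewrite agree ?differ.
Qed.

End Realization.

(** * The target collections and the computed search *)

Definition labelsE : seq (seq nat) :=
  [:: [:: 1;2;3;5;6]; [:: 1;2;4;5;6]; [:: 1;3;4;5;6]; [:: 2;3;4;5;6];
      [:: 1;2;3;5;7]; [:: 1;2;4;5;7]; [:: 1;3;4;5;7]; [:: 2;3;4;5;7];
      [:: 1;2;3;6;7]; [:: 1;2;4;6;7]; [:: 1;3;4;6;7]; [:: 2;3;4;6;8];
      [:: 2;3;4;7;8]; [:: 2;3;6;7;8]; [:: 2;4;6;7;8]; [:: 3;4;6;7;8]].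

Definition labelsF : seq (seq nat) :=
  [:: [:: 1;2;3;5;7]; [:: 1;2;4;5;7]; [:: 1;3;4;5;7]; [:: 2;3;4;5;7];
      [:: 1;2;3;6;7]; [:: 1;2;4;6;7]; [:: 1;3;4;6;7]; [:: 2;3;4;6;7];
      [:: 1;2;3;6;8]; [:: 1;2;4;6;8]; [:: 1;3;4;6;8]; [:: 2;3;4;6;8];
      [:: 1;2;3;5;8]; [:: 1;2;4;5;8]; [:: 1;3;4;5;8]; [:: 2;3;4;5;8]].

Definition indicator (w : seq nat) : seq bool := [seq k.+1 \in w | k <- iota 0 8].

Definition supports (L : seq pattern) : seq (seq bool) := map (map (@isSome bool)) L.

(** [t] lists the position assigned to each label. Inclusion in [W] suffices, as both sides will
    have sixteen members. *)
Definition relabels (M W : seq (seq bool)) (t : seq nat) : bool :=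
  perm_eq t (iota 0 8) && all (fun r => map (nth false r) t \in W) M.

Definition pair_degrees (M : seq (seq bool)) : seq (seq nat) :=
  [seq [seq count (fun r => nth false r x && nth false r y) M | y <- iota 0 8] | x <- iota 0 8].

(* Backtracking over the relabellings that preserve the pair degrees; only the
   final test [relabels] matters for correctness. *)
Fixpoint find_relabelling k (D DW : seq (seq nat)) M W t : bool :=
  if k is k'.+1 then
    lazy_has (fun x =>
      if lazy_all (fun i => nth 0 (nth [::] D x) (nth 0 (rcons t x) i)
                            == nth 0 (nth [::] DW (size t)) i) (iota 0 (size t).+1)
      then find_relabelling k' D DW M W (rcons t x) else false) (iota 0 8)
  else relabels M W t.

Definition matches (M W : seq (seq bool)) : bool :=
  find_relabelling 8 (pair_degrees M) (pair_degrees W) M W [::].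

Definition complete_ok (L : seq pattern) : bool :=
  let M := supports L in
  all (fun r => size r == 8) M &&
  (if matches M (map indicator labelsE) then true else matches M (map indicator labelsF)).

(** [k] is fuel, and exhausting it is failure. A node in excess without children is a contradiction
    and passes. A balanced family must exceed ten faces; if its size is not 16 it passes, since it
    cannot be realized. *)
Fixpoint search k (L : seq pattern) : bool :=
  if k is k'.+1 then
    if branching L (flatten (map drops L)) None is Some cs then all (search k') cs
    else (10 < size L) && (if size L == 16 then complete_ok L else true)
  else false.

(* A face and a neighbour sharing four of its five fixed coordinates, with labels and signs
   normalised; the coordinate fixed only by the neighbour comes first. *)
Definition start : seq pattern :=
  [:: [:: Some true; None; Some false; Some true; Some true; Some true];
      [:: None; Some true; Some true; Some true; Some true; Some true]].

Lemma search_start : search 16 start.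
Proof. vm_cast_no_check (erefl true). Qed.

Lemma matchesP M W : matches M W -> exists t, relabels M W t.
Proof.
rewrite /matches; move: (pair_degrees _) (pair_degrees _) [::] => D DW t.
elim: 8 t => [|k IH] t; first by exists t.
by rewrite -[find_relabelling _ _ _ _ _ _]/(lazy_has _ _) lazy_hasE => /hasP[x _]; case: ifP => // _ /IH.
Qed.

(** * From the search to the classification *)

Section Classification.
Variables (n : nat) (A : {set face n}).
Hypothesis splitA : antipodal_splitting 5 A.
Implicit Types (a b p : face n) (B : seq (face n)) (S : {set 'I_n}) (i j : 'I_n)
  (phi : seq 'I_n) (eps : 'I_n -> bool).

Lemma relabels_equivalent phi eps B L (Ws : seq (seq nat)) t :
  realization A phi eps B L -> size B = 16 -> size Ws = 16 ->
  all (fun r => size r == 8) (supports L) ->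
  relabels (supports L) (map indicator Ws) t ->
  equivalent [set:: map lab Ws] (betaA A).
Proof.
case=> uphi BA uB Bphi -> sB sW /allP sz /andP[pt /allP tW].
have ut : uniq t by rewrite (perm_uniq pt) iota_uniq.
have st : size t = 8 by rewrite (perm_size pt) size_iota.
have tlt k : k < 8 -> nth 0 t k < 8.
  move=> k8; have : nth 0 t k \in iota 0 8 by rewrite -(perm_mem pt) mem_nth ?st.
  by rewrite mem_iota.
have sphi : size phi = 8.
  case: B sB BA uB Bphi sz tW => // b B _ _ _ _ sz _.
  by have /eqP := sz _ (mem_head _ _); rewrite !size_map.
have [i0 _] : exists i0, i0 \in phi.
  by case: phi sphi {uphi Bphi sz tW} => // i phi _; exists i; apply: mem_head.
(* Label [k.+1] goes to the coordinate at position [nth 0 t k]; [i0] is only a default. *)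
pose f (k : 'I_8) := nth i0 phi (nth 0 t k).
have finj : injective f.
  move=> k k' /eqP; rewrite nth_uniq ?sphi ?tlt // nth_uniq ?st // => /eqP.
  exact: val_inj.
(* The inclusion of [betaA A] in the image suffices, as the image has at most sixteen members. *)
exists f; split=> //; apply/eqP; rewrite eqEcard; apply/andP; split; last first.
  rewrite card_betaA // -sW -(size_map lab) (leq_trans (leq_imset_card _ _)) //.
  by rewrite cardsE card_size.
apply/subsetP=> U /imsetP[a aA ->{U}].
(* The sixteen distinct bases from [B] exhaust [betaA A]. *)
have [b bB Eb] : exists2 b, b \in B & beta a = beta b.
  apply/mapP; have sub : {subset map (@beta n) B <= enum (betaA A)}.
    by move=> _ /mapP[b /BA bA ->]; rewrite mem_enum imset_f.
  have le : size (enum (betaA A)) <= size (map (@beta n) B).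
    by rewrite -cardE card_betaA // size_map sB.
  by have [_ ->] := uniq_min_size uB sub le; rewrite mem_enum imset_f.
have := tW _ (map_f (map (@isSome bool)) (map_f (encode phi eps) bB)).
case/mapP=> w wW Ew; apply/imsetP; exists (lab w).
  by rewrite inE map_f.
have key (k : 'I_8) : (f k \in beta b) = (k.+1 \in w).
  have := congr1 (fun s => nth false s k) Ew.
  rewrite (nth_map 0) ?st // (nth_map 0) ?size_iota // nth_iota // add0n => <-.
  rewrite -map_comp (nth_map i0) ?sphi ?tlt //= inE.
  by rewrite -/(f k); case: (b _).
rewrite Eb; apply/setP=> i; apply/idP/imsetP.
  move=> ib; have iphi := Bphi b bB i ib.
  have lt8 : index i phi < 8 by rewrite -sphi index_mem.
  have it : index i phi \in t by rewrite (perm_mem pt) mem_iota.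
  have kt : index (index i phi) t < 8 by rewrite -st index_mem.
  have fk : f (Ordinal kt) = i by rewrite /f /= nth_index // nth_index.
  by exists (Ordinal kt); rewrite // inE -key fk.
by case=> k; rewrite inE -key => kb ->.
Qed.

Lemma branch_patterns phi eps B L q : realization A phi eps B L ->
  q \in flatten (map drops L) ->
  exists2 p, q = encode phi eps p & #|beta p| = 4 /\ {subset beta p <= phi}.
Proof.
case=> uphi BA uB Bphi -> /flattenP[_ /mapP[_ /mapP[b bB ->] ->]].
case/dropsP=> // i iphi [bi ->]; exists (update b i None) => //.
rewrite beta_update_None; split.
  by have := cardsD1 i (beta b); rewrite inE bi (card_beta splitA (BA b bB)) => -[].
by move=> j; rewrite inE => /andP[_ /(Bphi b bB)].
Qed.

(** A sign in excess at [S] is carried by some [b] in [B] with [S] in its base, so [S] is that base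
    less one coordinate and is tested among the [drops]. *)
Lemma no_excess_balanced phi eps B L : realization A phi eps B L ->
  {in flatten (map drops L), forall q, excess L q = false} ->
  forall S c, #|S| = 4 -> count_parity S c B <= count_parity S (~~ c) B.
Proof.
case=> uphi BA uB Bphi -> noex S c cS; rewrite leqNgt; apply/negP=> lt.
have /hasP[b bB /andP[Sb /eqP pb]] :
    has (fun b => (S \subset beta b) && (face_parity S b == c)) B.
  by rewrite has_count (leq_ltn_trans _ lt).
have [i Ei] : exists i, beta b :\: S = [set i].
  by apply/cards1P; rewrite cardsD (setIidPr Sb) (card_beta splitA (BA b bB)) cS.
have [iS ib] : i \notin S /\ i \in beta b by apply/andP; rewrite -in_setD Ei set11.
have bp : beta (update b i None) = S.
  by rewrite beta_update_None -Ei setDDr setDv set0U; apply/setIidPr.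
have pp : face_parity S (update b i None) = c.
  rewrite -pb; congr (odd _); apply: eq_card => k; rewrite !inE ffunE.
  by case: (eqVneq k i) iS => // -> /negPf ->.
have : excess (map (encode phi eps) B) (encode phi eps (update b i None)) = false.
  apply: noex; apply/flattenP; exists (drops (encode phi eps b)).
    by do 2 apply: map_f.
  apply/dropsP => //; exists i; first exact: Bphi ib.
  by split=> //; rewrite inE in ib.
rewrite excess_encode //; last by rewrite bp => k /(subsetP Sb); apply: Bphi.
by rewrite bp pp lt.
Qed.

(** Some child of a realizable node is realizable, so the induction follows actual subfamilies of
    [A] down to a leaf. *)
Lemma search_sound k L : realizable A L -> search k L ->
  equivalent collE (betaA A) \/ equivalent collF (betaA A).
Proof.
elim: k L => [|k IH] L [phi [eps [B rL]]] //=.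
case E: branching => [cs|].
  have [//|[q qL [ex ->]]] := branching_Some E.
  have [p Eq [cp pphi]] := branch_patterns rL qL; rewrite Eq in ex *.
  have [L' L'c rL'] := children_complete splitA rL cp pphi ex.
  by move/allP/(_ _ L'c); apply: IH.
have [_ noex] := branching_None E.
case: (rL) => _ BA uB _ EL; have sL : size L = size B by rewrite EL size_map.
rewrite sL => /andP[gt10].
have s16 := balanced_subfamily splitA BA uB (no_excess_balanced rL noex) gt10.
rewrite s16 /= => /andP[sz].
case: ifP => [mL _|_ mL]; have [t tW] := matchesP mL; [left|right];
  exact: relabels_equivalent rL s16 _ sz tW.
Qed.

(** A single face is unbalanced at each 4-subset of its base, which forces a neighbour that differs
    from it there, up to antipode, only at [i1]. *)
Lemma start_realizable : realizable A start.
Proof.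
have [a0 a0A] : exists a0, a0 \in A.
  by apply/card_gt0P; case: splitA => _ ->.
have [i0 i0b] : exists i0, i0 \in beta a0 by apply/card_gt0P; rewrite (card_beta splitA a0A).
pose p := update a0 i0 None; pose S := beta p.
have SE : S = beta a0 :\ i0 by apply: beta_update_None.
have cS : #|S| = 4.
  by have := cardsD1 i0 (beta a0); rewrite i0b (card_beta splitA a0A) SE => -[].
have Sa0 : S \subset beta a0 by rewrite SE subsetDl.
have pp : face_parity S p = face_parity S a0.
  congr (odd _); apply: eq_card => k; rewrite !inE !ffunE.
  by case: (k == i0).
have B0A : {subset [:: a0] <= A} by move=> b; rewrite inE => /eqP ->.
have lt : count_parity S (~~ face_parity S p) [:: a0] < count_parity S (face_parity S p) [:: a0].
  by rewrite /count_parity /= Sa0 pp eqxx; case: face_parity.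
have [a1 a1A [pa1 para1]] := new_face splitA B0A isT cS lt; rewrite inE => a1B.
have [i1 [v [a aa1 [pv pa]]]] := one_flip cS pa1 para1.
have ba : beta a = beta a1 by case: aa1 => ->; rewrite ?beta_antipode.
have aA : a \in A by case: aa1 => ->; rewrite ?antipode_in.
rewrite -ba in a1B pa1.
(* Otherwise [a] would have the same base as [a0]. *)
have i0a : i0 \notin beta a.
  apply: contraNN a1B => i0a; rewrite eq_sym eqEcard !(card_beta splitA) // leqnn andbT.
  by rewrite -(setD1K i0b) subUset sub1set i0a -SE.
have [j jA] : exists j, beta a :\: S = [set j].
  by apply/cards1P; rewrite cardsD (setIidPr pa1) (card_beta splitA aA) cS.
have [jS ja] : j \notin S /\ j \in beta a by apply/andP; rewrite -in_setD jA set11.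
have ji0 : j != i0 by apply: contraNneq i0a => <-.
have ja0 : j \notin beta a0 by move: jS; rewrite SE in_setD1 ji0.
have i1S : i1 \in S by rewrite inE pv.
have i1i0 : i1 != i0 by move: i1S; rewrite SE in_setD1 => /andP[].
have i1a0 : i1 \in beta a0 := subsetP Sa0 _ i1S.
pose rest := enum (S :\ i1).
have srest : size rest = 3.
  by rewrite -cardE; have := cardsD1 i1 S; rewrite i1S cS => -[].
have inphi k : k \in beta a0 -> k \in [:: i0, i1 & rest].
  move=> ka0; rewrite !inE mem_enum in_setD1 SE in_setD1 ka0 andbT.
  by case: (k == i0); case: (k == i1).
(* These signs encode all fixed entries of [a0], and the entry of [a] at [j], as true; then [a]
   reads false only at [i1]. *)
pose eps k := if (if k == j then a j else a0 k) is Some u then ~~ u else true.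
exists [:: j, i0, i1 & rest], eps, [:: a; a0]; split.
- rewrite /= !inE !negb_or ji0 enum_uniq !mem_enum !in_setD1 eqxx (negPf jS) andbF.
  rewrite eq_sym in i1i0; rewrite i1i0 {1}SE in_setD1 eqxx andbF !andbT.
  by apply: contraNneq jS => ->.
- by move=> b; rewrite !inE => /orP[] /eqP ->.
- by rewrite /= inE a1B.
- move=> b; rewrite !inE => /orP[] /eqP -> k kb; rewrite inE; last by rewrite inphi ?orbT.
  case: (eqVneq k j) => //= kj; apply: inphi; apply: (subsetP Sa0).
  apply/negPn/negP=> kS; have : k \in beta a :\: S by rewrite in_setD kS.
  by rewrite jA inE (negPf kj).
have map3 (R : 'I_n -> option bool) (s : seq 'I_n) : size s = 3 ->
    {in s, forall k, R k = Some true} -> [:: Some true; Some true; Some true] = map R s.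
  by case: s => [|k1 [|k2 [|k3 []]]] // _ H; rewrite /= !H // !inE eqxx ?orbT.
rewrite /start /encode /=.
have a0eps k : k \in beta a0 -> omap (addb (eps k)) (a0 k) = Some true.
  move=> ka0; have /negPf kj : k != j by apply: contraNneq ja0 => <-.
  by move: ka0; rewrite /eps kj inE; case: (a0 k) => // -[].
have aS k : k \in S -> k != i1 -> a k = a0 k.
  move=> kS ki1; rewrite pa // ffunE (negPf ki1) ffunE.
  by move: kS; rewrite SE in_setD1 => /andP[/negPf ->].
have restS k : k \in rest -> k \in S /\ k != i1.
  by rewrite mem_enum in_setD1 => /andP[].
congr [:: _ ; _].
- congr [:: _, _, _ & _].
  + by rewrite /eps eqxx; move: ja; rewrite inE; case: (a j) => // -[].
  + by move: i0a; rewrite inE negbK => /eqP ->.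
  + rewrite pa // ffunE eqxx /=; have := a0eps i1 i1a0.
    have -> : a0 i1 = Some v by move: pv; rewrite ffunE (negPf i1i0).
    by case: (eps i1) v {pv pa} => -[].
  + apply: map3 => // k /restS[kS ki1]; rewrite aS //; apply: a0eps.
    exact: (subsetP Sa0).
- have -> : a0 j = None by move: ja0; rewrite inE negbK => /eqP.
  rewrite (a0eps _ i0b) (a0eps _ i1a0) -map3 // => k /restS[kS _].
  by apply: a0eps; apply: (subsetP Sa0).
Qed.

End Classification.

Theorem theorem2 (n : nat) (A : {set face n}) :
  0 < n -> antipodal_splitting 5 A ->
  equivalent collE (betaA A) \/ equivalent collF (betaA A).
Proof.
move=> _ splitA; exact: (search_sound splitA (start_realizable splitA) search_start).
Qed.
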